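(* There is an absolute constant $c>0$ such that for every finite set $A\subset\mathbb{R}$ with $|A|\ge 2$, writing $D:=A-A$, $$|D/D|\ \ge\ c\,|D|^{\frac34}|A|^{\frac34}(\log|A|)^{-\frac58}\quad\text{and}\quad |D|^{\frac34}|A|^{\frac34}(\log|A|)^{-\frac58}\ \ge\ c\,|D|^{1+\frac18}(\log|D|)^{-\frac58}.$$ In particular, for every $K>0$ there is $C(K)>0$ such that if $A\subset\mathbb{R}$ is finite with $|A|\ge2$ and $|(A-A)/(A-A)|\le K|A|^2$, then $$|A-A|\le C(K)\,|A|^{2-\frac13}(\log|A|)^{\frac56}.$$
   Context: For finite $X,Y\subset\mathbb{R}$: $X-Y=\{x-y: x\in X,\,y\in Y\}$, $X/Y=\{x/y: x\in X,\,y\in Y,\,y\ne 0\}$. $|\cdot|$ denotes cardinality. Logarithms are to base $2$. *)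

(* Defs.v *)
From HB Require Import structures.
From mathcomp Require Import all_boot all_order all_algebra finmap.
From mathcomp Require Import all_classical reals topology normedtype sequences exp.

Set Implicit Arguments.
Unset Strict Implicit.
Unset Printing Implicit Defensive.

Import Order.TTheory GRing.Theory Num.Theory.

Local Open Scope fset_scope.
Local Open Scope ring_scope.

Definition diff_set (R : realType) (X Y : {fset R}) : {fset R} :=
  [fset x - y | x in X, y in Y].

Definition quot_set (R : realType) (X Y : {fset R}) : {fset R} :=
  [fset x / y | x in X, y in Y & y != 0].

Definition log2 (R : realType) (x : R) : R := ln x / ln 2.

Lemma in_diff_set (R : realType) (X Y : {fset R}) (z : R) :
  reflect (exists x y, [/\ x \in X, y \in Y & z = x - y]) (z \in diff_set X Y).
Proof.
apply: (iffP (imfset2P _ _ _ _ _)) => /=.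
  by move=> [x xX [y yY ->]]; exists x, y.
by move=> [x [y [xX yY ->]]]; exists x => //; exists y.
Qed.

Lemma in_quot_set (R : realType) (X Y : {fset R}) (z : R) :
  reflect (exists x y, [/\ x \in X, y \in Y, y != 0 & z = x / y])
          (z \in quot_set X Y).
Proof.
apply: (iffP (imfset2P _ _ _ _ _)) => /=.
  by move=> [x xX [y]]; rewrite !inE => /andP[yY y0] ->; exists x, y.
by move=> [x [y [xX yY y0 ->]]]; exists x => //; exists y; rewrite // !inE yY.
Qed.

(* Main.v *)
(* Write D = A - A and let U be the set of all ratios (a - b) / (c - b) with
   a, b, c in A.  For u = x / d in U, with x, d, d - x in D, and for nonzero
   p, q in D, the quotients P = p / d, P' = q / d, X = x / p, Y = (d - x) / q
   lie in D / D and satisfy P X + P' Y = 1 and P X = u.  This gives about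
   |U| |D|^2 incidences between the grid (D / D)^2 and at most |D / D|^2 lines,
   so |U| |D|^2 = O(|D / D|^(8/3)) by the Szemeredi-Trotter bound.  The same
   bound on the grid A^2 controls the number of collinear triples, and
   Cauchy-Schwarz yields |U| >= c |A|^2 / log |A|.

   For Cartesian products the incidence bound is elementary: cutting the grid
   into r^2 cells of consecutive elements, each line meets at most 2 r cells,
   and inside a cell two points determine a line. *)
Require Import Defs.
From mathcomp Require Import all_boot all_order all_algebra finmap.
From mathcomp Require Import all_classical reals topology normedtype sequences exp.
From mathcomp Require Import zify lra ring.

Import Order.TTheory GRing.Theory Num.Theory.

Local Open Scope fset_scope.
Local Open Scope ring_scope.

(** * Counting by fibres and collisions, and integer cubes *)

Lemma card_leq_size {T : choiceType} {U : eqType} (A : {fset T}) (s : seq U)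
    (f : T -> U) :
  {in A &, injective f} -> {in A, forall x, f x \in s} ->
  (#|` A| <= size s)%N.
Proof.
move=> finj fs; rewrite -(size_map f) uniq_leq_size //.
  by rewrite map_inj_in_uniq ?fset_uniq.
by move=> _ /mapP[x xA ->]; apply: fs.
Qed.

Lemma leq_card_in {T U : choiceType} (A : {fset T}) (B : {fset U})
    (f : T -> U) :
  {in A &, injective f} -> {in A, forall x, f x \in B} ->
  (#|` A| <= #|` B|)%N.
Proof. exact: card_leq_size. Qed.

Lemma card_fibers {T U : choiceType} (A : {fset T}) (B : {fset U})
    (f : T -> U) :
  {in A, forall x, f x \in B} ->
  #|` A| = (\sum_(u <- B) #|` [fset x in A | f x == u]|)%N.
Proof.
move=> fAB; rewrite card_fset_sum1.
transitivity (\sum_(x <- A) \sum_(u <- B) (f x == u))%N.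
  rewrite big_seq [RHS]big_seq; apply: eq_bigr => x xA.
  transitivity (\sum_(u <- B | f x == u) 1)%N; last first.
    by rewrite big_mkcond; apply: eq_bigr => u _; case: eqP.
  rewrite (big_rem (f x)) ?fAB //= eqxx big_seq_cond big1 ?addn0 // => u.
  by rewrite mem_rem_uniq ?fset_uniq // inE eq_sym => /andP[/andP[/negPf->]].
rewrite exchange_big /=; apply: eq_bigr => u _.
rewrite card_fset_sum1 -big_fset_condE /= [RHS]big_mkcond /=.
by apply: eq_bigr => x _; case: (f x == u).
Qed.

(* Each class of [f] contributes at most [1 + k (k - 1)], the second term
   counting its ordered pairs of distinct elements. *)
Lemma card_leq_collisions {T : choiceType} (S : {fset T}) (f : T -> nat)
    (r : nat) :
  {in S, forall x, (f x < r)%N} ->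
  (#|` S| <= r + #|` [fset p in S `*` S | (p.1 != p.2) && (f p.1 == f p.2)]|)%N.
Proof.
move=> fr.
pose rep x := head x [seq z <- enum_fset S | f z == f x].
have repP x : x \in S -> rep x \in S /\ f (rep x) = f x.
  move=> xS; have : x \in [seq z <- enum_fset S | f z == f x].
    by rewrite mem_filter eqxx.
  rewrite /rep; case E: [seq z <- _ | _] => [|y s] //= _.
  have : y \in [seq z <- enum_fset S | f z == f x] by rewrite E mem_head.
  by rewrite mem_filter => /andP[/eqP].
have repf x y : x \in S -> f x = f y -> rep x = rep y.
  move=> xS fxy; have : x \in [seq z <- enum_fset S | f z == f x].
    by rewrite mem_filter eqxx.
  by rewrite /rep fxy; case: [seq z <- _ | _].
(* [f] is injective on the elements that represent their own class, so there are at most [r] of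
   them; every other [x] yields the collision [(x, rep x)]. *)
pose S1 := [fset x in S | rep x == x].
have SI : S `&` S1 = S1 by apply/fsetIidPr/fsubsetP => x; rewrite !inE => /andP[].
rewrite -(cardfsID S1 S) SI leq_add //.
  rewrite -[leqRHS](size_iota 0); apply: (card_leq_size _ _ f).
    move=> x y; rewrite !inE /= => /andP[xS /eqP xr] /andP[yS /eqP yr] fxy.
    by rewrite -xr -yr; apply: repf.
  by move=> x; rewrite !inE mem_iota /= add0n => /andP[/fr].
apply: (leq_card_in _ _ (fun x => (x, rep x))); first by move=> x y _ _ [].
move=> x; rewrite !inE /= => /andP[]; move=> xr xS; rewrite xS /= in xr *.
by have [-> ->] := repP x xS; rewrite eq_sym xr eqxx.
Qed.

Lemma sum_fset_const {T : choiceType} (A : {fset T}) (n : nat) :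
  (\sum_(x <- A) n = #|` A| * n)%N.
Proof. by rewrite big_const_seq iter_addn_0 count_predT mulnC. Qed.

Lemma card_dep_pairs {T U : choiceType} (L : {fset T}) (X : {fset U})
    (S : T -> {fset U}) :
  {in L, forall l, {subset S l <= X}} ->
  #|` [fset q in L `*` X | q.2 \in S q.1]| = (\sum_(l <- L) #|` S l|)%N.
Proof.
move=> SX; rewrite (card_fibers _ L (fun q => q.1)); last first.
  by move=> q; rewrite !inE => /andP[/andP[]].
rewrite !big_seq; apply: eq_bigr => l lL.
apply/eqP; rewrite eqn_leq; apply/andP; split.
  apply: (leq_card_in _ _ (fun q => q.2)) => [p q|q]; rewrite !inE /=.
    move=> /andP[_ /eqP p1] /andP[_ /eqP q1] pq.
    by rewrite [p]surjective_pairing p1 pq -q1 -surjective_pairing.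
  by move=> /andP[/andP[_ +] /eqP <-].
apply: (leq_card_in _ _ (fun x => (l, x))) => [x y _ _ []//|x xS].
by rewrite !inE /= lL eqxx xS (SX l lL x xS).
Qed.

Lemma card_fsetM {T U : choiceType} (A : {fset T}) (B : {fset U}) :
  #|` A `*` B| = (#|` A| * #|` B|)%N.
Proof.
rewrite -sum_fset_const -(card_dep_pairs A B (fun=> B)); last by move=> l _ x.
by congr #|` _|; apply/fsetP => q; rewrite !inE; case: (q.2 \in B); rewrite ?andbF ?andbT.
Qed.

Lemma card_sqr_leq_collisions {T U : choiceType} (B : {fset T}) (V : {fset U})
    (f : T -> U) :
  {in B, forall x, f x \in V} ->
  (#|` B| ^ 2 <= #|` V| * #|` [fset p in B `*` B | f p.1 == f p.2]|)%N.
Proof.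
move=> fV; pose g u := #|` [fset x in B | f x == u]|.
have g2 : (\sum_(u <- V) g u ^ 2 <= #|` [fset p in B `*` B | f p.1 == f p.2]|)%N.
  rewrite [leqRHS](card_fibers _ V (fun p => f p.1)); last first.
    by move=> p; rewrite !inE => /andP[/andP[/fV]].
  apply: leq_sum => u _; rewrite /g -mulnn -card_fsetM.
  apply: fsubset_leq_card; apply/fsubsetP => p; rewrite !inE /=.
  by move=> /andP[/andP[-> /eqP->] /andP[-> /eqP->]]; rewrite eqxx.
rewrite (card_fibers B V f fV) -/g.
apply: leq_trans (leq_mul (leqnn _) g2).
have E : (2 * (\sum_(u <- V) g u) ^ 2 <=
    \sum_(u <- V) \sum_(v <- V) (g u ^ 2 + g v ^ 2))%N.
  rewrite -mulnn big_distrl big_distrr /=; apply: leq_sum => u _.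
  rewrite big_distrr big_distrr /=; apply: leq_sum => v _; exact: nat_Cauchy.
have E' : (\sum_(u <- V) \sum_(v <- V) (g u ^ 2 + g v ^ 2) =
    2 * (#|` V| * \sum_(u <- V) g u ^ 2))%N.
  rewrite (eq_bigr (fun u => #|` V| * g u ^ 2 + \sum_(v <- V) g v ^ 2)%N).
    by rewrite big_split /= sum_fset_const -big_distrr /= mul2n -addnn.
  by move=> u _; rewrite big_split /= sum_fset_const.
by move: E; rewrite E' leq_pmul2l.
Qed.

(** Telescoping: [j ^ 3 - (j - 1) ^ 3 <= 3 * j ^ 2]. The indicator makes the range independent of
    [k], so that the sum can later be exchanged with one over lines. *)
Lemma cube_leq k n : (k <= n)%N ->
  (k ^ 3 <= \sum_(1 <= j < n.+1) (j <= k) * (3 * j ^ 2))%N.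
Proof.
move=> kn; have -> : (\sum_(1 <= j < n.+1) (j <= k) * (3 * j ^ 2) =
    \sum_(1 <= j < k.+1) 3 * j ^ 2)%N.
  rewrite (big_cat_nat _ (n := k.+1)) //= [X in (_ + X)%N]big_nat_cond.
  rewrite [X in (_ + X)%N]big1 ?addn0 => [|j /andP[/andP[kj _] _]]; last first.
    by rewrite leqNgt kj.
  by apply: eq_big_nat => j /andP[_]; rewrite ltnS => ->; rewrite mul1n.
elim: k {kn} => [|k IH]; first by [].
rewrite big_nat_recr //=; move: IH; rewrite !expnS !expn0; lia.
Qed.

Lemma cube_root_approx N : (0 < N)%N ->
  exists s, [/\ (0 < s)%N, (N <= s ^ 3)%N & (s ^ 3 <= 8 * N)%N].
Proof.
move=> N0; have ex : exists s, (N <= s ^ 3)%N.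
  by exists N; rewrite -[leqLHS]expn1 leq_pexp2l.
case: (ex_minnP ex) => s Ns smin; exists s.
have s0 : (0 < s)%N by case: s Ns {smin} => //; rewrite leqNgt N0.
(* For [s >= 2] minimality gives [(s - 1) ^ 3 < N], and [s <= 2 * (s - 1)] costs the factor 8. *)
split=> //; case: s s0 Ns smin => [//|[|s]] _ _ smin.
  by rewrite exp1n; lia.
have : (s.+1 ^ 3 < N)%N by rewrite ltnNge; apply/negP => /smin; rewrite ltnn.
have : (s.+2 ^ 3 <= (2 * s.+1) ^ 3)%N by rewrite leq_exp2r //; lia.
rewrite expnMn; lia.
Qed.

(** * Incidences between lines and a Cartesian product *)

Section Incidences.
Context {R : realType}.
Implicit Types (X Y A : {fset R}) (L : {fset R * R}).

Definition rank X (x : R) : nat := #|` [fset z in X | z < x]|.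

(** Index of the run of [s] consecutive elements of [X] in which [x] falls; a pair of indices names
    a cell of the grid. *)
Definition block X (s : nat) (x : R) : nat := (rank X x %/ s)%N.

Lemma rank_mono X x y : x <= y -> (rank X x <= rank X y)%N.
Proof.
move=> xy; apply: fsubset_leq_card; apply/fsubsetP => z.
by rewrite !inE /= => /andP[-> /lt_le_trans ->].
Qed.

Lemma rank_inj X : {in X &, injective (rank X)}.
Proof.
have lt x y : x \in X -> x < y -> (rank X x < rank X y)%N.
  move=> xX xy; have xN : x \notin [fset z in X | z < x] by rewrite !inE ltxx andbF.
  have := cardfsU1 x [fset z in X | z < x]; rewrite xN add1n /rank => <-.
  apply: fsubset_leq_card; apply/fsubsetP => z.
  by rewrite !inE /= => /orP[/eqP->|/andP[-> /lt_trans ->//]]; rewrite xX xy.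
move=> x y xX yX rxy; case: (ltgtP x y) => // /lt.
  by move=> /(_ xX); rewrite rxy ltnn.
by move=> /(_ yX); rewrite rxy ltnn.
Qed.

Lemma block_mono X s x y : x <= y -> (block X s x <= block X s y)%N.
Proof. by move=> xy; rewrite leq_div2r ?rank_mono. Qed.

Lemma block_le X s x : (block X s x <= #|` X| %/ s)%N.
Proof.
rewrite leq_div2r // fsubset_leq_card //; apply/fsubsetP => z.
by rewrite !inE => /andP[].
Qed.

Lemma card_block X s v :
  (0 < s)%N -> (#|` [fset z in X | block X s z == v]| <= s)%N.
Proof.
move=> s0; rewrite -[leqRHS](size_iota (v * s)).
apply: (card_leq_size _ _ (rank X)) => [x y|x]; rewrite !inE /=.
  by move=> /andP[xX _] /andP[yX _]; apply: rank_inj.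
move=> /andP[_ /eqP <-]; rewrite mem_iota /block leq_divM /=.
by rewrite -mulSnr ltn_ceil.
Qed.

Definition block_pairs X s : {fset R * R} :=
  [fset p in X `*` X | block X s p.1 == block X s p.2].

Lemma card_block_pairs X s :
  (0 < s)%N -> (#|` block_pairs X s| <= #|` X| * s)%N.
Proof.
move=> s0; rewrite (card_fibers _ X (fun p => p.1)); last first.
  by move=> p; rewrite !inE => /andP[/andP[]].
rewrite -sum_fset_const !big_seq; apply: leq_sum => u uX.
apply: leq_trans (card_block X s (block X s u) s0).
apply: (leq_card_in _ _ (fun p => p.2)) => [p q|p]; rewrite !inE /=.
  move=> /andP[_ /eqP p1] /andP[_ /eqP q1] pq.
  by rewrite [p]surjective_pairing p1 pq -q1 -surjective_pairing.
by move=> /andP[/andP[/andP[_ ->] /eqP <-] /eqP ->]; rewrite eqxx.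
Qed.

(* A pair [l] stands for the non-vertical line [y = l.1 * x + l.2]. *)
Definition on_line X Y (l : R * R) : {fset R} :=
  [fset x in X | l.1 * x + l.2 \in Y].

(* [block X s x + block Y s y], or [block X s x - block Y s y] on decreasing
   lines, separates the cells met by a line, which is monotone. *)
Lemma incidence_bound X Y L s :
  (0 < s)%N -> {in L, forall l, l.1 != 0} ->
  (\sum_(l <- L) #|` on_line X Y l| <=
     #|` L| * (#|` X| %/ s + #|` Y| %/ s).+1 + (#|` X| * s) * (#|` Y| * s))%N.
Proof.
move=> s0 L0.
(* Pairs of distinct incidences of [l] inside one cell, given by their abscissas. *)
pose same l := [fset p in on_line X Y l `*` on_line X Y l |
  [&& p.1 != p.2, block X s p.1 == block X s p.2 &
    block Y s (l.1 * p.1 + l.2) == block Y s (l.1 * p.2 + l.2)]].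
have lineP l : l \in L -> (#|` on_line X Y l| <=
    (#|` X| %/ s + #|` Y| %/ s).+1 + #|` same l|)%N.
  move=> /L0 l0.
  pose f x := (block X s x + if (0 < l.1)%R then block Y s (l.1 * x + l.2)%R
    else #|` Y| %/ s - block Y s (l.1 * x + l.2)%R)%N.
  have lt_f x : (f x < (#|` X| %/ s + #|` Y| %/ s).+1)%N.
    by rewrite ltnS leq_add ?block_le //; case: ifP; rewrite ?block_le ?leq_subr.
  have fP x y : x <= y -> f x = f y -> block X s x = block X s y /\
      block Y s (l.1 * x + l.2) = block Y s (l.1 * y + l.2).
    move=> xy; rewrite /f; have := block_mono X s _ _ xy.
    have := block_le Y s (l.1 * x + l.2); have := block_le Y s (l.1 * y + l.2).
    case: ltP => l1.
      have /(block_mono Y s) : l.1 * x + l.2 <= l.1 * y + l.2.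
        by rewrite lerD2r ler_wpM2l // ltW.
      lia.
    have /(block_mono Y s) : l.1 * y + l.2 <= l.1 * x + l.2.
      by rewrite lerD2r ler_wnM2l.
    lia.
  apply: leq_trans (card_leq_collisions (on_line X Y l) f _ _) _ => //.
  rewrite leq_add2l fsubset_leq_card //; apply/fsubsetP => -[x y].
  rewrite !inE /= => /andP[-> /andP[-> /eqP fxy]] /=.
  case: (leP x y) => [xy|/ltW yx].
    by have [-> ->] := fP _ _ xy fxy; rewrite !eqxx.
  by have [-> ->] := fP _ _ yx (esym fxy); rewrite !eqxx.
pose Z := [fset q in L `*` (X `*` X) | q.2 \in same q.1].
have cardZ : (\sum_(l <- L) #|` same l| <= #|` Z|)%N.
  rewrite card_dep_pairs // => l lL p.
  by rewrite !inE /= => /andP[/andP[/andP[-> _] /andP[-> _]] _].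
have leZ : (#|` Z| <= (#|` X| * s) * (#|` Y| * s))%N.
  apply: (@leq_trans #|` block_pairs X s `*` block_pairs Y s|); last first.
    by rewrite card_fsetM leq_mul // card_block_pairs.
  (* The line is dropped, keeping the coordinates of its two points; distinct abscissas determine it
     again. *)
  pose g (q : (R * R) * (R * R)) := (q.2,
    (q.1.1 * q.2.1 + q.1.2, q.1.1 * q.2.2 + q.1.2)).
  apply: (leq_card_in _ _ g).
    move=> [[m k] [x y]] [[m' k'] [x' y']]; rewrite !inE /=.
    move=> /andP[_ /and3P[_ xy _]] _ [ex ey].
    rewrite -ex -ey => e1 e2.
    have em : (m - m') * (x - y) = 0 by move: e1 e2; lra.
    move/eqP: em; rewrite mulf_eq0 !subr_eq0 (negPf xy) orbF => /eqP em.
    by move: e1; rewrite em => /addrI ->.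
  move=> [[m k] [x y]]; rewrite !inE /=.
  by move=> /and5P[_ /andP[/andP[-> ->] /andP[-> ->]] _ -> ->].
apply: (@leq_trans (\sum_(l <- L) ((#|` X| %/ s + #|` Y| %/ s).+1 + #|` same l|))).
  by rewrite !big_seq; apply: leq_sum => l; apply: lineP.
by rewrite big_split /= sum_fset_const leq_add // (leq_trans cardZ).
Qed.

(** * Lines rich in points of the grid [A * A] *)

(** The argument is [((x1, x2), (y1, y2))], abscissas first, for the points [(x1, y1)] and
    [(x2, y2)]. *)
Definition line_through (q : (R * R) * (R * R)) : R * R :=
  let m := (q.2.2 - q.2.1) / (q.1.2 - q.1.1) in (m, q.2.1 - m * q.1.1).

Definition grid_lines A : {fset R * R} :=
  [fset line_through q | q in
    [fset q in (A `*` A) `*` (A `*` A) | (q.1.1 != q.1.2) && (q.2.1 != q.2.2)]].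

Lemma grid_lines_slope A l : l \in grid_lines A -> l.1 != 0.
Proof.
move=> /imfsetP[[[b c] [b' c']]] /=; rewrite !inE /= => /andP[_ /andP[bc bc']] ->.
by rewrite /= mulf_neq0 ?invr_eq0 // subr_eq0 eq_sym.
Qed.

Lemma card_grid_lines A : (#|` grid_lines A| <= #|` A| ^ 4)%N.
Proof.
apply: leq_trans (leq_imfset_card _ _ _) _.
apply: (@leq_trans #|` (A `*` A) `*` (A `*` A)|).
  by apply: fsubset_leq_card; apply/fsubsetP => q; rewrite !inE => /andP[].
by rewrite !card_fsetM; lia.
Qed.

Definition rich_lines A (j : nat) : {fset R * R} :=
  [fset l in grid_lines A | (j <= #|` on_line A A l|)%N].

(** The incidences on these lines number at least [L * j]. Cells of side about [8 * n / j] make the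
    linear term of the incidence bound at most half of this, leaving [L * j <= 2 * (n * s) ^ 2] with
    [s * j <= 9 * n]. The constant [512 = 8 ^ 3] is dictated by the trivial range [j < 8]. *)
Lemma card_rich_lines A j : (0 < j)%N ->
  (#|` rich_lines A j| * j ^ 3 <= 512 * #|` A| ^ 4)%N.
Proof.
move=> j0; set n := #|` A|; set L := #|` rich_lines A j|.
have Ln : (L <= n ^ 4)%N.
  apply: leq_trans (card_grid_lines A).
  by apply: fsubset_leq_card; apply/fsubsetP => l; rewrite !inE => /andP[].
have [j8|j8] := ltnP j 8.
  have : (j ^ 3 <= 8 ^ 3)%N by rewrite leq_exp2r // ltnW.
  by move=> /(leq_mul Ln); rewrite [leqRHS]mulnC.
have [nj|jn] := ltnP n j.
  suff -> : L = 0%N by [].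
  apply/eqP; rewrite cardfs_eq0 -fsubset0; apply/fsubsetP => l.
  rewrite !inE /= => /andP[_]; rewrite leqNgt (leq_ltn_trans _ nj) //.
  by apply: fsubset_leq_card; apply/fsubsetP => x; rewrite !inE => /andP[].
pose s := (8 * n %/ j).+1.
have jL : (L * j <= L * (n %/ s + n %/ s).+1 + (n * s) * (n * s))%N.
  apply: leq_trans (incidence_bound A A (rich_lines A j) s _ _) => //.
    rewrite -sum_fset_const !big_seq; apply: leq_sum => l.
    by rewrite !inE => /andP[].
  by move=> l; rewrite !inE => /andP[/grid_lines_slope].
have js1 : (8 * n < s * j)%N by apply: ltn_ceil.
have js2 : (s * j <= 9 * n)%N.
  by have := leq_divM (8 * n) j; rewrite /s mulSn; lia.
have d8 : (8 * (n %/ s) < j)%N.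
  rewrite -(ltn_pmul2l (isT : 0 < s)%N); have := leq_divM n s; lia.
have jL2 : (L * j <= 2 * ((n * s) * (n * s)))%N.
  have : (L * (2 * (n %/ s + n %/ s).+1) <= L * j)%N by rewrite leq_mul2l; lia.
  lia.
have nsj : (n * (s * j) <= n * (9 * n))%N by rewrite leq_mul2l js2 orbT.
have := leq_mul nsj nsj; have := leq_mul jL2 (leqnn (j * j)).
rewrite !expnS !expn0; lia.
Qed.

(** * Collinear triples and the number of ratios *)

Definition triples A : {fset R * (R * R)} :=
  [fset t in A `*` (A `*` A) | t.2.1 != t.2.2].

(** Affine coordinate of [a] in the frame sending [b] to 0 and [c] to 1, for [t = (a, (b, c))]. *)
Definition ratio (t : R * (R * R)) : R := (t.1 - t.2.1) / (t.2.2 - t.2.1).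

Definition ratios A : {fset R} := [fset ratio t | t in triples A].

(** Equal ratios of [(a, (b, c))] and [(a', (b', c'))] mean that [(a, a')], [(b, b')], [(c, c')] lie
    on one line, neither vertical nor horizontal. *)
Definition collinear A :=
  [fset p in triples A `*` triples A | ratio p.1 == ratio p.2].

Lemma card_collinear A : (#|` collinear A| <=
  \sum_(1 <= j < #|` A|.+1) #|` rich_lines A j| * (3 * j ^ 2))%N.
Proof.
pose S := on_line A A.
pose W := [fset q in grid_lines A `*` (A `*` (A `*` A)) |
  q.2 \in S q.1 `*` (S q.1 `*` S q.1)].
have collW : (#|` collinear A| <= #|` W|)%N.
  (* The line through [(b, b')] and [(c, c')], with the three abscissas; the ordinates are read off
     the line. *)
  pose g (p : (R * (R * R)) * (R * (R * R))) := (line_through (p.1.2, p.2.2), p.1).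
  have gE p : p \in collinear A -> let l := line_through (p.1.2, p.2.2) in
      [/\ l.1 * p.1.1 + l.2 = p.2.1, l.1 * p.1.2.1 + l.2 = p.2.2.1 &
          l.1 * p.1.2.2 + l.2 = p.2.2.2].
    case: p => [[a [b c]] [a' [b' c']]]; rewrite !inE /= /ratio /=.
    move=> /andP[/andP[/andP[_ bc] /andP[_ bc']] /eqP e].
    have cb : c - b != 0 by rewrite subr_eq0 eq_sym.
    have cb' : c' - b' != 0 by rewrite subr_eq0 eq_sym.
    have {}e : a' - b' = (a - b) / (c - b) * (c' - b') by rewrite e divfK.
    split; last by field.
      by rewrite -[RHS](subrK b') e; field.
    by ring.
  apply: (leq_card_in _ _ g) => [p q /gE pE /gE qE|p pC].
    case: p q pE qE => [[a [b c]] [a' [b' c']]] [[x [y z]] [x' [y' z']]].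
    rewrite /g /= => -[ea eb ec] [ex ey ez] [e1 e2 e3 e4 e5].
    subst x y z.
    have -> : a' = x' by rewrite -ea -ex e2 e1.
    have eb' : b' = y' by rewrite -[LHS]eb -[RHS]ey e2 e1.
    have ec' : c' = z' by rewrite -[LHS]ec -[RHS]ez e2 e1.
    by rewrite eb' ec'.
  have [ea eb ec] := gE p pC; case: p pC ea eb ec => [[a [b c]] [a' [b' c']]] pC.
  rewrite /W /S /= => ea eb ec; rewrite !inE /= ea eb ec.
  move: pC; rewrite !inE /= => /andP[/andP[/andP[/and3P[-> bA cA] bc]]].
  move=> /andP[/and3P[-> bA' cA'] bc'] e; rewrite bA cA bA' cA' !andbT.
  apply/imfsetP; exists ((b, c), (b', c')) => //=; rewrite !inE /=.
  by rewrite bA cA bA' cA' bc bc'.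
apply: (leq_trans collW).
rewrite (card_dep_pairs _ _ (fun l => S l `*` (S l `*` S l))) => [|l lL t]; last first.
  by rewrite !inE /= => /andP[/andP[-> _] /andP[/andP[-> _] /andP[-> _]]].
rewrite (eq_bigr (fun l => #|` S l| ^ 3)%N); last first.
  by move=> l _; rewrite !card_fsetM mulnn -expnS.
have Sn l : (#|` S l| <= #|` A|)%N.
  by apply: fsubset_leq_card; apply/fsubsetP => x; rewrite !inE => /andP[].
apply: (@leq_trans (\sum_(l <- grid_lines A) \sum_(1 <= j < #|` A|.+1)
    (j <= #|` S l|) * (3 * j ^ 2))%N).
  by apply: leq_sum => l _; apply: cube_leq.
rewrite exchange_big /=; apply: leq_sum => j _; rewrite -big_distrl /=.
rewrite leq_mul2r; apply/orP; right.
rewrite card_fset_sum1 -big_fset_condE /= [leqRHS]big_mkcond /=.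
by apply: leq_sum => l _; rewrite /S; case: ifP.
Qed.

(** The excluded triples have [b = c] and are determined by [(a, b)]. *)
Lemma card_triples A :
  (#|` A| ^ 3 <= #|` triples A| + #|` A| ^ 2)%N.
Proof.
have -> : (#|` A| ^ 3 = #|` A `*` (A `*` A)|)%N by rewrite !card_fsetM; lia.
rewrite -(cardfsID (triples A)) leq_add //.
  by apply: fsubset_leq_card; apply: fsubsetIr.
rewrite -mulnn -card_fsetM.
apply: (leq_card_in _ _ (fun t => (t.1, t.2.1))).
  move=> [a [b c]] [a' [b' c']]; rewrite !inE /=.
  move=> /andP[+ abc] /andP[+ abc'] [-> e].
  by rewrite abc abc' !andTb !negbK => /eqP <- /eqP <-; rewrite e.
by move=> [a [b c]]; rewrite !inE /= => /and4P[_ -> -> _].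
Qed.

(** Induction with [ln (1 - x) <= - x] at [x = 1 / (n + 2)]. *)
Lemma harmonic_le_ln n : (0 < n)%N ->
  \sum_(1 <= j < n.+1) j%:R^-1 <= 1 + ln n%:R :> R.
Proof.
elim: n => // -[|n] IH _.
  by rewrite big_nat1 ln1 invr1 addr0.
rewrite big_nat_recr //=; apply: (@le_trans _ _ (1 + ln n.+1%:R + n.+2%:R^-1)).
  by rewrite lerD2r IH.
rewrite -addrA lerD2l -lerBrDl.
have n1 : 0 < n.+1%:R :> R by rewrite ltr0n.
have n2 : 0 < n.+2%:R :> R by rewrite ltr0n.
have E : (n.+1%:R / n.+2%:R : R) = 1 + - n.+2%:R^-1.
  by rewrite -(natr1 n.+1); field; rewrite nat1r natr1 gt_eqF.
have : ln (n.+1%:R / n.+2%:R) <= - n.+2%:R^-1 :> R.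
  by rewrite E le_ln1Dx // ltrN2 invf_lt1 // ltr1n.
by rewrite lnM ?lnV ?posrE ?invr_gt0 // lerNr opprB.
Qed.

Lemma log2_ge1 n : (2 <= n)%N -> 1 <= log2 n%:R :> R.
Proof.
move=> n2; have ln2 : 0 < ln 2 :> R by rewrite ln_gt0 // ltr1n.
by rewrite /log2 ler_pdivlMr // mul1r ler_ln ?posrE ?ler_nat ?ltr0n // ltnW.
Qed.

Lemma ln_le_log2 n : (2 <= n)%N -> ln n%:R <= log2 n%:R :> R.
Proof.
move=> n2; have ln2 : 0 < ln 2 :> R by rewrite ln_gt0 // ltr1n.
rewrite /log2 ler_pdivlMr // ler_piMr ?ln_ge0 ?ler1n 1?ltnW //.
have := @le_ln1Dx R 1; rewrite -[1 + 1]/(2 : R); apply; lra.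
Qed.

Lemma card_ratios A : (2 <= #|` A|)%N ->
  #|` A|%:R ^+ 2 <= 12288 * #|` ratios A|%:R * log2 #|` A|%:R :> R.
Proof.
set n := #|` A| => n2.
have CS : (#|` triples A| ^ 2 <= #|` ratios A| * #|` collinear A|)%N.
  by apply: card_sqr_leq_collisions => t tA; apply/imfsetP; exists t.
have n0 : 0 < n%:R :> R by rewrite ltr0n ltnW.
have coll : #|` collinear A|%:R <= 3072 * n%:R ^+ 4 * log2 n%:R :> R.
  have := card_collinear A; rewrite -/n -(ler_nat R) => /le_trans; apply.
  rewrite natr_sum.
  (* The rich-line bound makes the [j]-th term at most [3 * 512 * n ^ 4 / j]; then
     [1 + ln n <= 2 * log2 n] doubles 1536. *)
  apply: (@le_trans _ _ (1536 * n%:R ^+ 4 * \sum_(1 <= j < n.+1) j%:R^-1)).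
    rewrite mulr_sumr !big_nat; apply: ler_sum => j /andP[j0 _].
    have := card_rich_lines A j j0; rewrite -/n -(ler_nat R) natrM natrX natrM natrX => H.
    have {}j0 : 0 < j%:R :> R by rewrite ltr0n.
    rewrite ler_pdivlMr //; move: H; lra.
  have := harmonic_le_ln n (ltnW n2); have := ln_le_log2 n n2.
  have := log2_ge1 n n2 => l1 l2 H.
  have -> : 3072 * n%:R ^+ 4 * log2 n%:R = 1536 * n%:R ^+ 4 * (2 * log2 n%:R) :> R.
    by ring.
  apply: ler_wpM2l; first by rewrite mulr_ge0 ?exprn_ge0.
  by apply: (le_trans H); lra.
(* Here [n >= 2] gives [n ^ 2 <= n ^ 3 / 2]. Squaring yields the factor 4 in [12288 = 4 * 3072]. *)
have tr : n%:R ^+ 3 <= 2 * #|` triples A|%:R :> R.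
  have : (n ^ 3 <= 2 * #|` triples A|)%N.
    by have := card_triples A; rewrite -/n !expnS expn0; nia.
  by rewrite -(ler_nat R) natrM natrX.
have {}tr : n%:R ^+ 6 <= 4 * #|` triples A|%:R ^+ 2 :> R.
  have -> : n%:R ^+ 6 = (n%:R ^+ 3) ^+ 2 :> R by ring.
  have -> : 4 * #|` triples A|%:R ^+ 2 = (2 * #|` triples A|%:R) ^+ 2 :> R by ring.
  by rewrite lerXn2r ?nnegrE ?exprn_ge0 ?mulr_ge0.
rewrite -(ler_pM2r (exprn_gt0 4 n0)) -exprD.
apply: (le_trans tr); move: CS; rewrite -(ler_nat R) natrX natrM => CS.
have U0 : 0 <= #|` ratios A|%:R :> R by [].
have := ler_wpM2l U0 coll; lra.
Qed.

(** * From ratios to the size of [D / D] *)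

(** For [x = a - b] and [d = c - b], the difference [d - x = c - a] is again in [D]. *)
Lemma ratiosP A u : u \in ratios A ->
  exists xd : R * R, let D := diff_set A A in
    [/\ xd.1 \in D, xd.2 \in D `\ 0, xd.2 - xd.1 \in D & u = xd.1 / xd.2].
Proof.
move=> /imfsetP[[a [b c]]] /=; rewrite !inE /= => /andP[/and3P[aA bA cA] bc] ->.
exists (a - b, c - b); split=> //=.
- by apply/in_diff_set; exists a, b.
- rewrite !inE subr_eq0 eq_sym bc /=; apply/in_diff_set; exists c, b; by split.
- by apply/in_diff_set; exists c, a; split=> //; ring.
Qed.

(* If [x], [d] and [d - x] are in [D] then, for all nonzero [p] and [q] in [D],
   the line [p / d * X + q / d * Y = 1], which is [Y = - (p / q) X + d / q],
   contains the point [(x / p, (d - x) / q)] of the grid. *)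
Lemma card_quot_set_lower A : let D := diff_set A A in
  (0 < #|` quot_set D D|)%N ->
  (#|` ratios A| ^ 3 * #|` D `\ 0%R| ^ 6 <= 4096 * #|` quot_set D D| ^ 8)%N.
Proof.
move=> D; set Q := quot_set D D; set N := #|` Q|; set U := ratios A.
set D' := D `\ 0 => N0.
(* With about [N ^ 2] lines, [s] of order [N ^ (1 / 3)] balances both terms of the incidence bound
   at [N ^ (8 / 3)]. *)
have [s [s0 Ns sN]] := cube_root_approx N N0.
pose L := [fset (- p.1, p.2) | p in [fset p in Q `*` Q | p.1 != 0]].
have cardL : (#|` L| <= N * N)%N.
  apply: leq_trans (leq_imfset_card _ _ _) _; rewrite -card_fsetM.
  by apply: fsubset_leq_card; apply/fsubsetP => q; rewrite !inE => /andP[].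
have L0 : {in L, forall l, l.1 != 0}.
  by move=> _ /imfsetP[p + ->]; rewrite !inE oppr_eq0 => /andP[].
have I := incidence_bound Q Q L s s0 L0.
pose W := [fset w in L `*` Q | w.2 \in on_line Q Q w.1].
have leW : (#|` W| <= \sum_(l <- L) #|` on_line Q Q l|)%N.
  by rewrite card_dep_pairs // => l _ x; rewrite !inE => /andP[].
have geW : (#|` U| * (#|` D'| * #|` D'|) <= #|` W|)%N.
  (* Fixes one pair [(x, d)] for each ratio; [(0, 0)] is a dummy value outside [U]. *)
  have /choice[rep repP] : forall u, exists xd : R * R, u \in U ->
      [/\ xd.1 \in D, xd.2 \in D', xd.2 - xd.1 \in D & u = xd.1 / xd.2].
    move=> u; have [/ratiosP[xd ?]|_] := boolP (u \in U); first by exists xd.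
    by exists (0, 0).
  have nz z : z \in D' -> z != 0 by rewrite !inE => /andP[].
  pose g (z : R * (R * R)) := let xd := rep z.1 in
    ((- (z.2.1 / z.2.2), xd.2 / z.2.2), xd.1 / z.2.1).
  rewrite -!card_fsetM; apply: (leq_card_in _ _ g).
    move=> [u [p q]] [u' [p' q']].
    rewrite !in_fsetM /g /= => /and3P[uU /nz p0 /nz q0] /and3P[uU' /nz p0' /nz q0'].
    have [_ /nz d0 _ uE] := repP _ uU; have [_ /nz d0' _ uE'] := repP _ uU'.
    move=> [/oppr_inj e1 e2 e3].
    have uu' : u = u'.
      (* The image determines [x / p], [p / q] and [d / q], hence [u = x / d]; then [d] is known,
         and [q] and [p] follow. *)
      have E x y z w : y != 0 -> z != 0 -> w != 0 ->
        x / w = (x / y) * (y / z) / (w / z) :> R.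
        by move=> y0 z0 w0; field; rewrite y0 z0 w0.
      by rewrite uE uE' (E _ p q) // e1 e2 e3 -E.
    subst u'; have qq : q = q' by apply/invr_inj/(mulfI d0).
    by rewrite -qq in e1 *; have -> : p = p' by apply: (mulIf _ e1); rewrite invr_eq0.
  move=> [u [p q]]; rewrite !in_fsetM /= => /and3P[uU pD qD].
  have [xD dD dxD _] := repP _ uU.
  have DQ x y : x \in D -> y \in D' -> x / y \in Q.
    by rewrite !inE => xX /andP[y0 yD]; apply/in_quot_set; exists x, y.
  have D'D z : z \in D' -> z \in D by rewrite !inE => /andP[].
  have p0 := nz _ pD; have q0 := nz _ qD; have xp := DQ _ _ xD pD.
  rewrite /W !inE /= xp andbT; apply/and3P; split=> //.
    apply/imfsetP; exists (p / q, (rep u).2 / q) => //=.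
    by rewrite !inE /= mulf_neq0 ?invr_eq0 // !DQ ?D'D.
  have -> : - (p / q) * ((rep u).1 / p) + (rep u).2 / q = ((rep u).2 - (rep u).1) / q.
    by field; rewrite p0 q0.
  exact: DQ.
have NsQ : (N %/ s <= s * s)%N.
  rewrite -(leq_pmul2r s0); apply: leq_trans (leq_divM N s) _.
  by apply: leq_trans Ns _; lia.
have main : (#|` U| * (#|` D'| * #|` D'|) <= 4 * (N * N) * (s * s))%N.
  apply: leq_trans geW _; apply: leq_trans leW _; apply: leq_trans I _.
  have ss : (0 < s * s)%N by rewrite muln_gt0 s0.
  have r3 : ((N %/ s + N %/ s).+1 <= 3 * (s * s))%N by lia.
  have := leq_mul cardL r3; rewrite -/N (mulnACA N s N s) => H.
  by apply: leq_trans (leq_add H (leqnn _)) _; rewrite -mulnDr -mulSnr mulnCA mulnA.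
have -> : (#|` U| ^ 3 * #|` D'| ^ 6 = (#|` U| * (#|` D'| * #|` D'|)) ^ 3)%N.
  by rewrite !expnMn -expnD.
apply: (@leq_trans ((4 * (N * N) * (s * s)) ^ 3)%N); first by rewrite leq_exp2r.
(* After cubing, [s] enters only through [s ^ 3 <= 8 * N], which gives [4096 = 64 * 8 ^ 2]. *)
have -> : ((4 * (N * N) * (s * s)) ^ 3 = 64 * N ^ 6 * (s ^ 3 * s ^ 3))%N.
  by rewrite !expnMn -!expnD.
have -> : (4096 * N ^ 8 = 64 * N ^ 6 * (8 * N * (8 * N)))%N.
  by rewrite (mulnACA 8 N 8 N) (mulnACA 64) (mulnn N) -expnD.
by rewrite leq_mul2l leq_mul ?orbT.
Qed.

(** * Eliminating the ratios and taking roots *)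

Lemma card_diff_set_ge A : (0 < #|` A|)%N -> (#|` A| <= #|` diff_set A A|)%N.
Proof.
rewrite cardfs_gt0 => /fset0Pn[a aA].
apply: (leq_card_in _ _ (fun x => x - a)) => [x y _ _ /addIr//|x xA].
by apply/in_diff_set; exists x, a.
Qed.

Lemma card_diff_set_le A : (#|` diff_set A A| <= #|` A| ^ 2)%N.
Proof.
rewrite -mulnn -card_fsetM.
apply: (@leq_trans #|` [fset p.1 - p.2 | p in A `*` A]|).
  apply: fsubset_leq_card; apply/fsubsetP => z /in_diff_set[x [y [xA yA ->]]].
  by apply/imfsetP; exists (x, y) => //; rewrite !inE /= xA.
exact: leq_imfset_card.
Qed.

(* [12288 ^ 3] comes from cubing [card_ratios] and [512 ^ 2 = 2 ^ 6 * 4096]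
   from [|D| <= 2 |D \ 0|] and [card_quot_set_lower]. *)
Definition loss : R := 12288 ^+ 3 * 512 ^+ 2.

Lemma quot_set_power_bound A : (2 <= #|` A|)%N ->
  #|` diff_set A A|%:R ^+ 6 * #|` A|%:R ^+ 6 <=
    loss * #|` quot_set (diff_set A A) (diff_set A A)|%:R ^+ 8
      * log2 #|` A|%:R ^+ 3 :> R.
Proof.
move=> A2; set D := diff_set A A; set n := #|` A| in A2 *; set lg : R := log2 n%:R.
have nD : (n <= #|` D|)%N by apply/card_diff_set_ge/ltnW.
have D2 : (#|` D| <= 2 * #|` D `\ 0%R|)%N.
  have := leq_trans A2 nD; rewrite (cardfsD1 0 D); move: #|` _|%N => m.
  by case: (0 \in D) => /=; lia.
have Q0 : (0 < #|` quot_set D D|)%N.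
  rewrite cardfs_gt0; apply/fset0Pn.
  have : (0 < #|` D `\ 0%R|)%N by have := leq_trans A2 nD; lia.
  rewrite cardfs_gt0 => /fset0Pn[d]; rewrite !inE => /andP[d0 dD].
  by exists (d / d); apply/in_quot_set; exists d, d.
have lg0 : 0 <= lg by apply: le_trans ler01 (log2_ge1 _ A2).
have H1 := card_ratios A A2; rewrite -/n -/lg in H1.
have H2 := card_quot_set_lower A Q0; rewrite -/D in H2.
move: H2; rewrite -(ler_nat R) natrM natrX natrX natrM natrX => H2.
have {}D2 : #|` D|%:R <= 2 * #|` D `\ 0%R|%:R :> R by rewrite -natrM ler_nat.
set U : R := #|` ratios A|%:R in H1 H2; set D' : R := #|` D `\ 0|%:R in H2 D2.
have D6 : #|` D|%:R ^+ 6 <= (2 * D') ^+ 6 by rewrite lerXn2r ?nnegrE ?mulr_ge0.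
have n6 : (n%:R ^+ 2) ^+ 3 <= (12288 * U * lg) ^+ 3 :> R.
  by rewrite lerXn2r ?nnegrE ?exprn_ge0 //; apply: le_trans H1; rewrite exprn_ge0.
have := ler_pM (exprn_ge0 6 (ler0n R #|` D|)) (exprn_ge0 3 (exprn_ge0 2 (ler0n R n))) D6 n6.
rewrite -exprM => /le_trans; apply.
have lg3 : 0 <= lg ^+ 3 by rewrite exprn_ge0.
have := ler_wpM2r lg3 H2.
have E : (2 * D') ^+ 6 * (12288 * U * lg) ^+ 3 =
  (64 * 12288 ^+ 3) * (U ^+ 3 * D' ^+ 6 * lg ^+ 3) :> R by ring.
rewrite {}E => H3; have -> : loss * #|` quot_set D D|%:R ^+ 8 * lg ^+ 3 =
  (64 * 12288 ^+ 3) * (4096 * #|` quot_set D D|%:R ^+ 8 * lg ^+ 3) :> R.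
  by rewrite /loss; ring.
by rewrite ler_pM2l // mulr_gt0 ?exprn_gt0.
Qed.

Lemma loss_ge1 : 1 <= loss.
Proof. by rewrite -[1]mulr1 ler_pM // ?exprn_ege1 // ler1n. Qed.

Lemma powRX (x a : R) m : (x `^ a) ^+ m = x `^ (a * m%:R).
Proof. by rewrite powRrM powR_mulrn // powR_ge0. Qed.

Lemma quot_set_lower A : (2 <= #|` A|)%N ->
  loss^-1 * #|` diff_set A A|%:R `^ (3 / 4) * #|` A|%:R `^ (3 / 4)
    * log2 #|` A|%:R `^ (- (5 / 8)) <=
  #|` quot_set (diff_set A A) (diff_set A A)|%:R :> R.
Proof.
move=> A2; set D := diff_set A A; have H := quot_set_power_bound A A2; rewrite -/D in H.
have l1 := log2_ge1 _ A2; have l0 := lt_le_trans ltr01 l1.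
have loss0 := lt_le_trans ltr01 loss_ge1.
(* Eighth powers turn the exponents [3 / 4] and [- (5 / 8)] into 6 and -5. *)
rewrite -(ler_pXn2r (isT : (0 < 8)%N)) ?nnegrE ?mulr_ge0 ?powR_ge0 ?invr_ge0 ?(ltW loss0) //.
rewrite !exprMn !powRX.
have -> : (3 / 4 * 8%:R : R) = 6%:R by lra.
have -> : (- (5 / 8) * 8%:R : R) = - 5%:R by lra.
rewrite powRN !powR_mulrn ?ler0n ?(ltW l0) //.
rewrite ler_pdivrMr ?exprn_gt0 // -mulrA exprVn ler_pdivrMl ?exprn_gt0 //.
(* There is slack: [loss <= loss ^ 8], and the third power of the logarithm is below the fifth, both
   bases being at least 1. *)
apply: (le_trans H); rewrite mulrA ler_pM //.
- by rewrite mulr_ge0 ?exprn_ge0 // ltW.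
- by rewrite exprn_ge0 // ltW.
- by rewrite ler_wpM2r ?exprn_ge0 // -[leLHS]expr1 ler_weXn2l // loss_ge1.
- by rewrite ler_weXn2l.
Qed.

End Incidences.

(** * The three inequalities of the theorem *)

Theorem theorem27 (R : realType) :
  (exists c : R, 0 < c /\
    forall A : {fset R}, (2 <= #|` A|)%N ->
      let D := diff_set A A in
      #|` quot_set D D|%:R >=
        c * #|` D|%:R `^ (3 / 4) * #|` A|%:R `^ (3 / 4)
          * log2 #|` A|%:R `^ (- (5 / 8))
      /\
      #|` D|%:R `^ (3 / 4) * #|` A|%:R `^ (3 / 4)
          * log2 #|` A|%:R `^ (- (5 / 8)) >=
        c * #|` D|%:R `^ (1 + 1 / 8) * log2 #|` D|%:R `^ (- (5 / 8)))
  /\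
  (forall K : R, 0 < K ->
    exists C : R, 0 < C /\
      forall A : {fset R}, (2 <= #|` A|)%N ->
        #|` quot_set (diff_set A A) (diff_set A A)|%:R <= K * #|` A|%:R ^+ 2 ->
        #|` diff_set A A|%:R <=
          C * #|` A|%:R `^ (2 - 1 / 3) * log2 #|` A|%:R `^ (5 / 6)).
Proof.
have loss0 : 0 < loss :> R := lt_le_trans ltr01 loss_ge1.
split.
  exists loss^-1; split=> [|A A2 D]; first by rewrite invr_gt0.
  split; first exact: quot_set_lower.
  have nD : (#|` A| <= #|` D|)%N by apply/card_diff_set_ge/ltnW.
  have n0 : 0 < #|` A|%:R :> R by rewrite ltr0n ltnW.
  have D0 : 0 < #|` D|%:R :> R by rewrite (lt_le_trans n0) ?ler_nat.
  have ln2 : 0 < ln 2 :> R by rewrite ln_gt0 // ltr1n.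
  have l1 : 1 <= log2 #|` A|%:R :> R := log2_ge1 _ A2.
  have l0 := lt_le_trans ltr01 l1.
  have lD : log2 #|` A|%:R <= log2 #|` D|%:R :> R.
    by rewrite /log2 ler_pM2r ?invr_gt0 // ler_ln ?posrE // ler_nat.
  have lD0 := lt_le_trans l0 lD.
  apply: ler_pM; rewrite ?mulr_ge0 ?powR_ge0 ?invr_ge0 ?(ltW loss0) //.
    apply: (@le_trans _ _ (#|` D|%:R `^ (1 + 1 / 8))).
      by rewrite ler_piMl ?powR_ge0 // invf_le1 ?loss_ge1.
    (* The excess [|D| ^ (3 / 8)] is at most [|A| ^ (3 / 4)] because [|D| <= |A| ^ 2]. *)
    have -> : (1 + 1 / 8 : R) = 3 / 4 + 2%:R^-1 * (3 / 4) by lra.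
    rewrite powRD; last by rewrite (gt_eqF D0) implybT.
    rewrite ler_wpM2l ?powR_ge0 // powRrM.
    apply: ge0_ler_powR; rewrite ?nnegrE ?powR_ge0 ?divr_ge0 ?ler0n //.
    rewrite -(ler_pXn2r (isT : (0 < 2)%N)) ?nnegrE ?powR_ge0 // powRX mulVf ?pnatr_eq0 //.
    by rewrite powRr1 // -natrX ler_nat card_diff_set_le.
  rewrite !powRN lef_pV2 ?posrE ?powR_gt0 ?l0 ?lD0 //.
  by apply: ge0_ler_powR; rewrite ?nnegrE ?(ltW l0) ?(ltW lD0) ?divr_ge0.
move=> K K0; exists ((K * loss) `^ (4 / 3)).
split=> [|A A2 HK]; first by rewrite powR_gt0 ?mulr_gt0.
set D := diff_set A A in HK *.
have n0 : 0 < #|` A|%:R :> R by rewrite ltr0n ltnW.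
have l0 : 0 < log2 #|` A|%:R :> R := lt_le_trans ltr01 (log2_ge1 _ A2).
have H := le_trans (quot_set_lower A A2) HK; rewrite -/D in H.
(* Dividing by [|A| ^ (3 / 4)] leaves [|A| ^ (5 / 4)]; the power [4 / 3] then gives the claim and
   the constant [(K * loss) ^ (4 / 3)]. *)
have {}H : #|` D|%:R `^ (3 / 4) <=
    K * loss * #|` A|%:R `^ (5 / 4) * log2 #|` A|%:R `^ (5 / 8) :> R.
  have E : #|` A|%:R ^+ 2 = #|` A|%:R `^ (5 / 4) * #|` A|%:R `^ (3 / 4) :> R.
    rewrite -powRD; last by rewrite (gt_eqF n0) implybT.
    by rewrite -powR_mulrn ?ler0n //; congr (_ `^ _); lra.
  rewrite E powRN ler_pdivrMr ?powR_gt0 // -!mulrA ler_pdivrMl // in H.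
  rewrite -(ler_pM2r (powR_gt0 (3 / 4) n0)); apply: (le_trans H).
  by rewrite le_eqVlt; apply/orP; left; apply/eqP; ring.
have -> : #|` D|%:R = (#|` D|%:R `^ (3 / 4)) `^ (4 / 3) :> R.
  by rewrite -powRrM (_ : 3 / 4 * (4 / 3) = 1) ?powRr1 //; lra.
have -> : (2 - 1 / 3 : R) = 5 / 4 * (4 / 3) by lra.
have -> : (5 / 6 : R) = 5 / 8 * (4 / 3) by lra.
rewrite (powRrM _ (5 / 4) (4 / 3)) (powRrM _ (5 / 8) (4 / 3)).
have KL0 : 0 <= K * loss by rewrite mulr_ge0 ?(ltW K0) ?(ltW loss0).
rewrite -!powRM ?KL0 ?(mulr_ge0 KL0) ?powR_ge0 //.
apply: ge0_ler_powR => //; rewrite ?nnegrE ?divr_ge0 ?powR_ge0 //.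
exact: mulr_ge0 (mulr_ge0 KL0 (powR_ge0 _ _)) (powR_ge0 _ _).
Qed.
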